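(* For any countable ordinal $\alpha$, there exists a compact metric space $(X, d)$ for which $\mathrm{iht}(X, d) = \alpha$.
   Context: For a compact metric space $(X,d)$, let $\mathrm{Iso}(X,d)$ be the set of all isometries of $X$ onto itself, and let $x\sim y$ iff $\varphi(x)=y$ for some $\varphi\in\mathrm{Iso}(X,d)$. The iso-derivative $(X^{(1)},d^{(1)})$ is the quotient set $X^{(1)}=X/{\sim}$ with the greatest pseudometric $d^{(1)}$ making the canonical projection $\pi_X^{(1)}\colon X\to X^{(1)}$ non-expansive (i.e. 1-Lipschitz); $d^{(1)}$ is known to be a metric, so $(X^{(1)},d^{(1)})$ is a compact metric space. The transfinite sequence of iso-derivatives $(X^{(\alpha)},d^{(\alpha)})$ and canonical projections $\pi_\beta^\gamma\colon X^{(\beta)}\to X^{(\gamma)}$ ($\beta\leqslant\gamma$) is defined by transfinite recursion. $X^{(0)}=X$, $\pi_0^0=\mathrm{id}_X$. At successors, $(X,d)^{(\alpha+1)}=(X^{(\alpha)},d^{(\alpha)})^{(1)}$, $\pi_\beta^{\alpha+1}=\pi_{X^{(\alpha)}}^{(1)}\circ\pi_\beta^\alpha$ for $\beta\leqslant\alpha$, and $\pi_{\alpha+1}^{\alpha+1}=\mathrm{id}$. At a limit ordinal $\alpha$, $((X,d)^{(\alpha)},\{\pi_\beta^\alpha\}_{\beta<\alpha})$ is the inductive limit (direct limit/colimit, which exists and is unique up to isometry), in the category of compact metric spaces and non-expansive mappings, of the direct system $(\{(X^{(\beta)},d^{(\beta)})\}_{\beta<\alpha},\{\pi_\beta^\gamma\}_{\beta\leqslant\gamma<\alpha})$,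 and $\pi_\alpha^\alpha=\mathrm{id}$. The iso-height of $(X,d)$ is the ordinal $\mathrm{iht}(X,d)=\min\{\alpha\colon \pi_\alpha^{\alpha+1}\text{ is an isometry}\}$ (such ordinals exist). Countable ordinals include finite ones. *)

(* Defs.v *)
From mathcomp Require Import all_boot all_order all_algebra.
From mathcomp Require Import all_classical all_reals all_analysis.
From mathcomp Require Import wochoice.

Set Implicit Arguments.
Unset Strict Implicit.
Unset Printing Implicit Defensive.

Import Order.TTheory GRing.Theory Num.Theory.

Local Open Scope classical_set_scope.
Local Open Scope ring_scope.

Section Maps.
Context {R : realType}.

Definition nonexpansive (X Y : metricType R) (f : X -> Y) : Prop :=
  forall x y, mdist (f x) (f y) <= mdist x y.

(* Surjectivity is not part of the notion; it is required separately in
   [iso_equiv]. *)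
Definition is_isometry (X Y : metricType R) (f : X -> Y) : Prop :=
  forall x y, mdist (f x) (f y) = mdist x y.

Definition iso_equiv (X : metricType R) (x y : X) : Prop :=
  exists phi : X -> X,
    [/\ is_isometry phi, forall z, exists t, phi t = z & phi x = y].

Definition is_pseudometric (T : Type) (rho : T -> T -> R) : Prop :=
  [/\ forall x y, 0 <= rho x y,
      forall x, rho x x = 0,
      forall x y, rho x y = rho y x &
      forall x y z, rho x z <= rho x y + rho y z].

(* [p : X -> Y] is the canonical projection of [X] onto its iso-derivative:
   the first two fields say that the set [Y], with [p], is the quotient of [X]
   by [iso_equiv]; the last two say that the distance of [Y] is the greatest
   pseudometric on that set making [p] non-expansive. *)
Record is_iso_derivative (X Y : metricType R) (p : X -> Y) : Prop := {
  isoder_surj : forall y, exists x, p x = y;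
  isoder_fiber : forall x x', p x = p x' <-> iso_equiv x x';
  isoder_nonexpansive : nonexpansive p;
  isoder_greatest : forall rho : Y -> Y -> R, is_pseudometric rho ->
    (forall x x', rho (p x) (p x') <= mdist x x') ->
    forall y y', rho y y' <= mdist y y' }.

End Maps.

(* An ordinal is given as the order type of a (reflexive, boolean) relation
   [le] satisfying [well_order]; the elements of its carrier stand for the
   smaller ordinals. *)
Section WellOrder.
Context {I : eqType} (le : rel I).

Definition slt : rel I := fun b c => le b c && (b != c).

Lemma slt_le b c : slt b c -> le b c.
Proof. by case/andP. Qed.

Definition is_zero (a : I) : Prop := forall b, le a b.

Definition is_succ (a a' : I) : Prop :=
  slt a a' /\ forall c, slt a c -> le a' c.

Definition is_limit (a : I) : Prop :=
  (exists b, slt b a) /\ forall b, slt b a -> exists2 c, slt b c & slt c a.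

(* [le] with a new greatest element [None] added: the successor ordinal. *)
Definition succ_le : rel (option I) := fun x y =>
  match x, y with
  | _, None => true
  | None, Some _ => false
  | Some b, Some c => le b c
  end.

End WellOrder.

Section Limits.
Context {R : realType} {I : eqType} (le : rel I) (X : I -> metricType R).
Variable p : forall b c, le b c -> X b -> X c.

Definition is_cocone (a : I) (Z : metricType R)
    (f : forall b, slt le b a -> X b -> Z) : Prop :=
  (forall b (hb : slt le b a), nonexpansive (f b hb)) /\
  (forall b c (hb : slt le b a) (hc : slt le c a) (hbc : le b c) x,
     f c hc (p hbc x) = f b hb x).

(* [L], with the maps [i], is the colimit of the system restricted to the
   indices below [a], in the category of compact metric spaces and
   non-expansive maps. *)
Definition is_inductive_limit (a : I) (L : metricType R)
    (i : forall b, slt le b a -> X b -> L) : Prop :=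
  [/\ compact [set: L], is_cocone i &
      forall (Z : metricType R), compact [set: Z] ->
      forall f : (forall b, slt le b a -> X b -> Z), is_cocone f ->
      exists! u : L -> Z,
        nonexpansive u /\ forall b (hb : slt le b a) x, u (i b hb x) = f b hb x].

End Limits.

(* A transfinite sequence of iso-derivatives of [X], indexed by the ordinals
   below the order type of [le]. Colimits being unique only up to isometry, the
   sequence is specified by its recursive clauses, which determine it up to
   isometry. *)
Record iso_derivatives (R : realType) (I : eqType) (le : rel I)
    (X : metricType R) := IsoDerivatives {
  der :> I -> metricType R;
  der_compact : forall a, compact [set: der a];
  dproj : forall b c, le b c -> der b -> der c;
  dproj_id : forall a (h : le a a) x, dproj h x = x;
  der_zero : forall a, is_zero le a -> der a = X;
  der_succ : forall a a' (h : le a a'), is_succ le a a' ->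
    is_iso_derivative (dproj h);
  dproj_succ : forall b a a' (hb : le b a) (h : le a a') (hb' : le b a'),
    is_succ le a a' -> forall x, dproj hb' x = dproj h (dproj hb x);
  der_limit : forall a, is_limit le a ->
    is_inductive_limit dproj (fun b (hb : slt le b a) => dproj (slt_le hb)) }.

Arguments dproj {R I le X} i {b c} _ _.

Definition stable_at (R : realType) (I : eqType) (le : rel I)
    (X : metricType R) (D : iso_derivatives le X) (a : I) : Prop :=
  exists (a' : I) (h : le a a'), is_succ le a a' /\ is_isometry (dproj D h).

(* iht(X) = alpha, where alpha is the order type of the well-order [le] on [W].
   The sequence is indexed by the ordinals up to alpha + 1: [Some (Some w)]
   are those below alpha, [Some None] is alpha and [None] is alpha + 1. *)
Definition iht_eq (R : realType) (X : metricType R) (W : eqType) (le : rel W)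
    : Prop :=
  exists D : iso_derivatives (succ_le (succ_le le)) X,
    stable_at D (Some None) /\
    forall b, stable_at D b -> succ_le (succ_le le) (Some None) b.

(* Main.v *)
Require Import Defs.
From HB Require Import structures.
From mathcomp Require Import all_boot all_order all_algebra.
From mathcomp Require Import all_classical all_reals all_analysis.
From mathcomp Require Import wochoice.
From mathcomp Require Import lra.

(** The space.  Let [W] be the given well-order and [n : W -> nat] an injection.
    The points of the space are the finite strictly descending words of
    letters of [W], each letter carrying a boolean label, such that no label
    [true] occurs after a label [false]; two extra points, the rulers, are
    added.  Words are the vertices of a tree, and the distance is a path metric
    on it: the edge leading to a word [u ++ [:: a]] has length the product of
    the weights [2^-(n b + 1)] of the letters [b] of [u ++ [:: a]].  The
    branches at a vertex shrink to that vertex, and there is no infinite branch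
    since the words descend; so the space is compact ([space_compact], by
    ultrafilters and well-founded induction).

    The recursive picture is the following.  Let [X_b] be the space of labelled
    words over the letters below [b], and [Z_b] the space of words over the
    same letters with all labels [false].  Below the root hang, for every
    letter [b], a copy of [X_b] (label [true]) and a copy of [Z_b] (label
    [false]), at mirror positions.  Derivation turns [X_b] into [Z_b] in [b]
    steps, and not earlier; from then on the two copies can be exchanged, so
    they are identified at step [b + 1].

    The stages.  Accordingly stage [c] is the subspace of those words whose
    labels [true] sit at letters [>= c], and the projection to it changes the
    other labels into [false].  This is a non-expansive retraction onto a
    subspace, so the quotient distance is the induced one, and a limit stage,
    being the intersection of the previous ones, is a colimit: a word has
    finitely many letters, hence reaches its final labelling before the limit
    ([relabel_limit], [stage_inductive_limit]).

    The isometries.  The distance from a word to a ruler exceeds a constant by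
    the distance from the word to the root, its height.  The latter is a binary
    expansion which determines the word up to labels ([height_inj]).  The
    rulers are fixed by every isometry ([ruler_fixed]), so an isometry can only
    change labels ([isometry_word]).  At stage [g], flipping the label of [g] is
    an isometry ([iso_equiv_flip]); and a label [true] at a letter [b > g] is
    preserved, because below it, and below no letter labelled [false], there
    are two branches with the same letter [g] ([isometry_prefix]).  Hence the
    orbits at stage [g] are the fibres of the projection to the next stage
    ([proj_fiber]).  The stages below the order type of [W] are therefore all
    unstable, and the one at the order type, where all labels are [false], is
    stable. *)

Set Implicit Arguments.
Unset Strict Implicit.
Unset Printing Implicit Defensive.

Import Order.TTheory GRing.Theory Num.Theory.

Local Open Scope classical_set_scope.
Local Open Scope ring_scope.

(** * The path metric on the tree of words *)

Section WordMetric.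
Context {R : realType} {W : eqType} (n : W -> nat).
Implicit Types (a b c : W * bool) (x y z u v : seq (W * bool)).

(** The exponent starts at [1] so that heights stay below [1], which makes the
    height a binary expansion. *)
Definition weight a : R := (2^-1) ^+ (n a.1).+1.

(** The length of the path from the root to [x]. *)
Fixpoint height x : R := if x is a :: x' then weight a * (1 + height x') else 0.

Fixpoint word_dist x y : R :=
  match x, y with
  | a :: x', b :: y' =>
      if a == b then weight a * word_dist x' y' else height x + height y
  | _, _ => height x + height y
  end.

Lemma weight_gt0 a : 0 < weight a.
Proof. by rewrite exprn_gt0// invr_gt0. Qed.

Lemma weight_le_half a : weight a <= 2^-1.
Proof.
rewrite /weight exprS ler_piMr ?invr_ge0// exprn_ile1 ?invr_ge0//.
by rewrite invf_le1 ?ler1n.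
Qed.

Lemma height_ge0 x : 0 <= height x.
Proof.
by elim: x => //= a x IH; rewrite mulr_ge0 ?(ltW (weight_gt0 a))// addr_ge0.
Qed.

Lemma height_lt1 x : height x < 1.
Proof.
elim: x => [|a x IH] /=; first exact: ltr01.
have := weight_gt0 a; have := weight_le_half a; have := height_ge0 x; nra.
Qed.

Lemma height_cons_gt0 a x : 0 < height (a :: x).
Proof. by rewrite /= mulr_gt0 ?weight_gt0// ltr_wpDr ?ltr01 ?height_ge0. Qed.

Lemma height_cons_lt a x : height (a :: x) < (2^-1) ^+ n a.1.
Proof.
have h1 := height_lt1 x; have h0 := height_ge0 x.
rewrite /= /weight exprS; set p := _ ^+ n a.1.
have p0 : 0 < p by rewrite exprn_gt0// invr_gt0.
have : 2^-1 * 2 = 1 :> R by rewrite mulVf.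
set i := 2^-1; move=> i2; have : i = 2^-1 by []. nra.
Qed.

Lemma height_map_fst x y : map fst x = map fst y -> height x = height y.
Proof.
elim: x y => [|a x IH] [|b y]//= [ab /IH ->].
by rewrite /weight ab.
Qed.

(** The height of a word starting with the letter [b] is at least [2^-(n b + 1)]
    and less than [2^-(n b)].  These dyadic intervals are disjoint, so the height
    gives away the first letter, then the height of the rest. *)
Lemma height_inj x y : injective n -> height x = height y ->
  map fst x = map fst y.
Proof.
move=> n_inj; elim: x y => [|a x IH] [|b y] //.
- by move=> h; have := height_cons_gt0 b y; rewrite -h ltxx.
- by move=> h; have := height_cons_gt0 a x; rewrite h ltxx.
have step c d (s t : seq (W * bool)) : (n c.1 < n d.1)%N ->
    height (d :: t) < height (c :: s).
  move=> cd; apply: (lt_le_trans (height_cons_lt d t)).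
  rewrite /= /weight (@le_trans _ _ ((2^-1) ^+ (n c.1).+1))//.
    by rewrite ler_wiXn2l// ?invr_ge0// invf_le1 ?ler1n.
  by rewrite ler_peMr ?exprn_ge0 ?invr_ge0// lerDl height_ge0.
move=> h; have [lt_ab|lt_ba|/n_inj ab] := ltngtP (n a.1) (n b.1).
- by have := step _ _ x y lt_ab; rewrite h ltxx.
- by have := step _ _ y x lt_ba; rewrite h ltxx.
move: h; rewrite /= /weight ab => /mulfI; rewrite expf_neq0 ?invr_eq0 ?pnatr_eq0//.
by move=> /(_ isT)/addrI/IH ->.
Qed.

Lemma word_dist0l x : word_dist [::] x = height x.
Proof. exact: add0r. Qed.

Lemma word_dist0r x : word_dist x [::] = height x.
Proof. by case: x => [|a x]; exact: addr0. Qed.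

Lemma word_dist_cons a x y :
  word_dist (a :: x) (a :: y) = weight a * word_dist x y.
Proof. by rewrite /= eqxx. Qed.

Lemma word_dist_neq a b x y : a != b ->
  word_dist (a :: x) (b :: y) = height (a :: x) + height (b :: y).
Proof. by rewrite /= => /negPf ->. Qed.

Lemma word_distxx x : word_dist x x = 0.
Proof. by elim: x => [|a x IH] /=; rewrite ?addr0// eqxx IH mulr0. Qed.

Lemma word_dist_sym x y : word_dist x y = word_dist y x.
Proof.
elim: x y => [|a x IH] [|b y] /=; try by rewrite addrC.
by rewrite [b == a]eq_sym; case: eqP => [->|_]; [rewrite IH|rewrite addrC].
Qed.

Lemma word_dist_le x y : word_dist x y <= height x + height y.
Proof.
elim: x y => [|a x IH] [|b y] //=; case: eqP => // <-.
by have := IH y; have := weight_gt0 a; nra.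
Qed.

Lemma height_le x y : height x <= word_dist x y + height y.
Proof.
elim: x y => [|a x IH] [|b y]; rewrite ?word_dist0l ?word_dist0r.
- by rewrite addr0.
- by rewrite addr_ge0 ?height_ge0.
- by rewrite addr0.
have [<-|ab] := eqVneq a b.
  rewrite word_dist_cons /=; have := IH y; have := weight_gt0 a; nra.
by rewrite word_dist_neq// -addrA lerDl addr_ge0 ?height_ge0.
Qed.

Lemma word_dist_eq0 x y : word_dist x y = 0 -> x = y.
Proof.
elim: x y => [|a x IH] [|b y]; rewrite ?word_dist0l ?word_dist0r => // h.
- by have := height_cons_gt0 b y; rewrite h ltxx.
- by have := height_cons_gt0 a x; rewrite h ltxx.
have [ab|ab] := eqVneq a b.
  move: h; rewrite -ab word_dist_cons => /eqP.
  by rewrite mulf_eq0 gt_eqF ?weight_gt0//= => /eqP/IH ->.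
have := height_cons_gt0 a x; have := height_cons_gt0 b y.
by move: h; rewrite word_dist_neq// => h ha hb; exfalso; lra.
Qed.

(** Unless the three words start with the same letter, one of the two paths to
    [y] goes through the root, and the bounds by heights suffice. *)
Lemma word_dist_triangle y x z :
  word_dist x z <= word_dist x y + word_dist y z.
Proof.
elim: x y z => [|a x IH] y z.
  by rewrite !word_dist0l addrC word_dist_sym height_le.
case: z => [|c z]; first by rewrite !word_dist0r height_le.
case: y => [|b y]; first by rewrite word_dist0r word_dist0l word_dist_le.
have hx := height_le (a :: x) (b :: y); have hz := height_le (c :: z) (b :: y).
have hxz := word_dist_le (a :: x) (c :: z).
rewrite (word_dist_sym (c :: z)) in hz.
have [ab|ab] := eqVneq a b; last by rewrite (word_dist_neq x y ab); lra.
have [bc|bc] := eqVneq b c; last by rewrite (word_dist_neq y z bc); lra.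
rewrite -{}bc -{}ab !word_dist_cons -mulrDr ler_pM2l ?weight_gt0//.
Qed.

Lemma word_dist_lt2 x y : word_dist x y < 2.
Proof.
have := word_dist_le x y; have := height_lt1 x; have := height_lt1 y; lra.
Qed.

(** ** Words with a common prefix *)

Definition scale u : R := \prod_(a <- u) weight a.

Lemma scale_gt0 u : 0 < scale u.
Proof. by apply: prodr_gt0 => a _; exact: weight_gt0. Qed.

Lemma scale_le1 u : scale u <= 1.
Proof.
apply: prodr_ile1 => a; rewrite ltW ?weight_gt0//=.
by have := weight_le_half a; lra.
Qed.

Lemma word_dist_cat u x y :
  word_dist (u ++ x) (u ++ y) = scale u * word_dist x y.
Proof.
elim: u => [|a u IH]; rewrite /scale ?big_nil ?mul1r// big_cons.
by rewrite !cat_cons word_dist_cons IH mulrA.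
Qed.

Lemma scale_map_fst u v : map fst u = map fst v -> scale u = scale v.
Proof.
elim: u v => [|a u IH] [|b v]//= [ab /IH].
by rewrite /scale !big_cons /weight ab => ->.
Qed.

Lemma height_cat_ge u x : scale u * height x <= height (u ++ x).
Proof.
elim: u => [|a u IH]; rewrite /scale ?big_nil ?mul1r// big_cons -/(scale u) /=.
rewrite -mulrA ler_pM2l ?weight_gt0//; lra.
Qed.

(** Two branches that separate inside the prefixes [u], [v] are further apart
    than any two branches separating after a common prefix of that shape. *)
Lemma word_dist_prefix_eq u v x y : map fst u = map fst v ->
  word_dist (u ++ x) (v ++ y) <= scale u * (height x + height y) -> u = v.
Proof.
elim: u v => [|a u IH] [|b v]//= [ab uv].
have [<-|neq] := eqVneq a b => h.
  congr (_ :: _); apply: IH => //; move: h.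
  by rewrite /scale big_cons -mulrA ler_pM2l ?weight_gt0.
move: h; rewrite /scale big_cons -/(scale u).
have -> : weight b = weight a by rewrite /weight ab.
have := height_cat_ge u x; have := height_cat_ge v y.
rewrite -(scale_map_fst uv) => h1 h2; have w0 := weight_gt0 a.
move=> h3; exfalso.
have : weight a * (1 + height (u ++ x) + (1 + height (v ++ y))) <=
  weight a * (scale u * (height x + height y)) by lra.
by rewrite ler_pM2l//; lra.
Qed.

End WordMetric.

(** * Relabelling words *)

Section Relabelling.
Context {R : realType} {W : eqType} (n : W -> nat).
Implicit Types (b d : W) (a c : W * bool)
  (x y z u v : seq (W * bool)) (k : pred W).

Definition relabel k x : seq (W * bool) := [seq (a.1, a.2 && k a.1) | a <- x].

Lemma map_fst_relabel k x : map fst (relabel k x) = map fst x.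
Proof. by rewrite -map_comp. Qed.

Lemma relabel_id k x : all (fun a => a.2 ==> k a.1) x -> relabel k x = x.
Proof.
elim: x => //= -[b l] x IH /andP[/= bl /IH ->]; congr ((_, _) :: _).
by case: l bl => //= ->.
Qed.

Lemma relabel_relabel k k' x : (forall b, k' b -> k b) ->
  relabel k' (relabel k x) = relabel k' x.
Proof.
move=> kk; rewrite /relabel -map_comp; apply: eq_map => -[b l] /=.
congr (_, _); rewrite -andbA; congr (_ && _).
by apply/andb_idl/kk.
Qed.

(** Two words separate no earlier after relabelling.  Where they did separate,
    the old path went through the separation point, and its length is the sum
    of two heights, which relabelling does not change. *)
Lemma relabel_nonexpansive k x y :
  word_dist (R := R) n (relabel k x) (relabel k y) <= word_dist n x y.
Proof.
have hr z : height (R := R) n (relabel k z) = height n z.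
  by apply: height_map_fst; rewrite map_fst_relabel.
elim: x y => [|a x IH] [|b y]; rewrite ?word_dist0l ?word_dist0r ?hr//.
have [<-|ab] := eqVneq a b.
  by rewrite [relabel _ _]/= -/(relabel _ _) !word_dist_cons /weight/=
     ler_pM2l ?IH// exprn_gt0// invr_gt0.
rewrite [leRHS]word_dist_neq// -(hr (a :: x)) -(hr (b :: y)).
exact: word_dist_le.
Qed.

Variable g : W.

Definition flip_letter a : W * bool := if a.1 == g then (a.1, ~~ a.2) else a.

(** The recursion stops at a letter labelled [false]: after it no letter may be
    labelled [true], so that [g] cannot change its label there. *)
Fixpoint flip x : seq (W * bool) :=
  if x is a :: x' then
    flip_letter a :: (if (a.1 != g) && a.2 then flip x' else x')
  else [::].

Lemma flip_letterK : involutive flip_letter.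
Proof.
move=> [b l]; rewrite /flip_letter /=.
by have [->|/negPf bg] := eqVneq b g; rewrite /= ?eqxx ?negbK// bg.
Qed.

Lemma flip_letter1 a : (flip_letter a).1 = a.1.
Proof. by rewrite /flip_letter; case: ifP. Qed.

Lemma flipK : involutive flip.
Proof.
elim=> [//|a x IH] /=; rewrite flip_letterK flip_letter1; congr (_ :: _).
rewrite /flip_letter; have [ag|ag] //= := eqVneq a.1 g.
by case: (boolP a.2) => //= a2; rewrite ?a2.
Qed.

Lemma map_fst_flip x : map fst (flip x) = map fst x.
Proof.
elim: x => [//|a x IH] /=; rewrite flip_letter1; congr (_ :: _).
by case: ifP.
Qed.

Lemma flip_isometry x y :
  word_dist (R := R) n (flip x) (flip y) = word_dist n x y.
Proof.
have hf z : height (R := R) n (flip z) = height n z.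
  by apply: height_map_fst; rewrite map_fst_flip.
elim: x y => [|a x IH] [|b y]; rewrite ?word_dist0l ?word_dist0r ?hf//.
have [<-|ab] := eqVneq a b.
  rewrite [flip _]/= [flip (_ :: y)]/= !word_dist_cons /weight flip_letter1.
  by case: ifP => _; rewrite ?IH.
rewrite [RHS]word_dist_neq// -(hf (a :: x)) -(hf (b :: y)) word_dist_neq//.
by rewrite (can_eq flip_letterK).
Qed.

End Relabelling.

(** * Admissible words *)

Section Words.
Context {W : eqType} (le : rel W).
Implicit Types (b d : W) (a c : W * bool)
  (x y z u v : seq (W * bool)) (k : pred W).

(** The order in which letters may follow one another in a word: strictly
    descending, and no label [true] after a label [false]. *)
Definition letter_order a c := slt le c.1 a.1 && (c.2 ==> a.2).

Definition admissible k x :=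
  pairwise letter_order x && all (fun a => a.2 ==> k a.1) x.

Definition upward_closed k := forall b d, k b -> le b d -> k d.

Lemma admissible_cons k a x : admissible k (a :: x) =
  [&& all (letter_order a) x, a.2 ==> k a.1 & admissible k x].
Proof.
rewrite /admissible pairwise_cons /= -!andbA; congr (_ && _).
by rewrite andbCA.
Qed.

Lemma admissible_catl k u v : admissible k (u ++ v) -> admissible k u.
Proof.
by rewrite /admissible pairwise_cat all_cat => /andP[/and3P[_ -> _] /andP[-> _]].
Qed.

Lemma admissible_weaken k k' x : (forall b, k' b -> k b) ->
  admissible k' x -> admissible k x.
Proof.
move=> kk /andP[px xk]; apply/andP; split=> //; apply: sub_all xk => a /implyP h.
by apply/implyP => /h/kk.
Qed.

Lemma relabel_admissible k k' x : upward_closed k' ->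
  admissible k x -> admissible k' (relabel k' x).
Proof.
move=> up /andP[px _]; apply/andP; split.
  rewrite /relabel pairwise_map; apply: sub_pairwise px => -[b l] [c m].
  rewrite /letter_order /= => /andP[cb /implyP lm]; rewrite cb /=.
  by apply/implyP => /andP[/lm -> kc] /=; apply: up kc (slt_le cb).
by rewrite /relabel all_map; apply/allP => a _ /=; apply/implyP => /andP[].
Qed.

Definition unlabelled x := all (fun a => ~~ a.2) x.

Lemma unlabelled_eq x y : unlabelled x -> unlabelled y ->
  map fst x = map fst y -> x = y.
Proof.
elim: x y => [|[b l] x IH] [|[c m] y]//= /andP[/= /negPf-> ux] /andP[/= /negPf-> uy].
by move=> [-> /IH ->].
Qed.

(** Labels are inherited backwards: nothing after a letter labelled [false] is
    labelled [true]. *)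
Lemma tail_unlabelled k a x : admissible k (a :: x) -> ~~ a.2 -> unlabelled x.
Proof.
rewrite admissible_cons => /andP[/allP ax _] na; apply/allP => c /ax.
by rewrite /letter_order (negPf na) implybF => /andP[].
Qed.


Section WellOrdered.
Hypothesis le_wo : well_order le.

Lemma wo_total : total le.
Proof.
move=> b d; have [|z [[+ zl] _]] := le_wo (A := [pred e | (e == b) || (e == d)]).
  by exists b; rewrite inE eqxx.
rewrite inE => /orP[]/eqP ze; move: zl; rewrite ze => zl.
  by rewrite zl// inE eqxx orbT.
by rewrite zl ?orbT// inE eqxx.
Qed.

Lemma wo_refl : reflexive le.
Proof. by move=> b; have := wo_total b b; rewrite orbb. Qed.

Lemma wo_antisym : antisymmetric le.
Proof.
move=> b d /andP[bd db].
have [|z [_ zu]] := le_wo (A := [pred e | (e == b) || (e == d)]).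
  by exists b; rewrite inE eqxx.
have in_b : minimum_of le [pred e | (e == b) || (e == d)] b.
  split; first by rewrite inE eqxx.
  by move=> e; rewrite inE => /orP[]/eqP -> //; exact: wo_refl.
have in_d : minimum_of le [pred e | (e == b) || (e == d)] d.
  split; first by rewrite inE eqxx orbT.
  by move=> e; rewrite inE => /orP[]/eqP -> //; exact: wo_refl.
by rewrite -(zu _ in_b) -(zu _ in_d).
Qed.

Lemma wo_trans : transitive le.
Proof.
move=> d b e bd de.
have [|z [[+ zl] _]] := le_wo (A := [pred t | [|| t == b, t == d | t == e]]).
  by exists b; rewrite inE eqxx.
have [zb zd ze] : [/\ le z b, le z d & le z e].
  by split; apply: zl; rewrite inE eqxx ?orbT.
rewrite inE => /or3P[]/eqP h; rewrite h in zb zd ze => //.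
  by have -> : b = d by apply: wo_antisym; rewrite bd zb.
have de' : d = e by apply: wo_antisym; rewrite de zd.
by rewrite -de'.
Qed.

Lemma wo_wf : well_founded (slt le).
Proof.
move=> b; apply: contrapT => nb.
have [|z [[+ zl] _]] := le_wo (A := [pred e | ~~ `[< Acc (slt le) e >]]).
  by exists b; rewrite inE; apply/asboolPn.
rewrite inE => /asboolPn; apply; constructor => e /andP[ez enz].
apply: contrapT => ne; move/negP: enz; apply; apply/eqP/wo_antisym.
by rewrite ez zl// inE; apply/asboolPn.
Qed.

Lemma sltNle b d : slt le b d = ~~ le d b.
Proof.
rewrite /slt; apply/idP/idP => [/andP[bd nbd]|ndb].
  by apply: contra nbd => db; apply/eqP/wo_antisym; rewrite bd.
have := wo_total b d; rewrite (negPf ndb) orbF => ->/=.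
by apply: contra ndb => /eqP ->; exact: wo_refl.
Qed.

End WellOrdered.

Section AdjacentPair.
Hypothesis le_wo : well_order le.
Variables (k : pred W) (g : W).
Hypothesis k_g : forall b, k b = le g b.

Lemma all_below_unlabelled x : all (fun a => a.2 ==> k a.1) x ->
  all (fun a => slt le a.1 g) x -> unlabelled x.
Proof.
move=> /allP kx /allP gx; apply/allP => a ax; apply/negP => a2.
have := kx _ ax; rewrite a2 k_g /=; have := gx _ ax.
by rewrite sltNle// => /negPf ->.
Qed.

Lemma tail_below_unlabelled a x : admissible k (a :: x) -> a.1 = g ->
  unlabelled x.
Proof.
rewrite admissible_cons => /and3P[/allP ax _ /andP[_ kx]] ag.
apply: all_below_unlabelled => //.
by apply/allP => c /ax/andP[+ _]; rewrite ag.
Qed.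

Lemma flip_admissible x : admissible k x -> admissible k (flip g x).
Proof.
elim: x => [//|a x IH] adm.
have := adm; rewrite admissible_cons => /and3P[/allP ax ka kx].
rewrite /=; have [ag|ag] /= := eqVneq a.1 g.
  rewrite admissible_cons kx andbT; apply/andP; split; last first.
    by rewrite /flip_letter ag eqxx /= k_g wo_refl// implybT.
  have /allP ux := tail_below_unlabelled adm ag.
  apply/allP => c cx; have /andP[ca _] := ax _ cx.
  by rewrite /letter_order flip_letter1 ca (negPf (ux _ cx)).
have -> : flip_letter g a = a by rewrite /flip_letter (negPf ag).
case: ifP => // a2; rewrite admissible_cons ka IH//= andbT.
have : all (slt le ^~ a.1) (map fst (flip g x)).
  by rewrite map_fst_flip all_map; apply/allP => c /ax/andP[].
rewrite all_map; apply: sub_all => c /= ca.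
by rewrite /letter_order ca a2 implybT.
Qed.

(** Letters above [g] keep their label, and letters below [g] have none left to
    lose, so only the label of [g] can be lost. *)
Lemma eq_relabel_flip k' x y : (forall b, k' b = slt le g b) ->
  admissible k x -> admissible k y -> relabel k' x = relabel k' y ->
  y = x \/ y = flip g x.
Proof.
move=> k'_g; elim: x y => [|a x IH] [|c y]//; first by left.
move=> admx admy [ac lac rxy].
have fxy : map fst x = map fst y.
  by rewrite -(map_fst_relabel k' x) rxy map_fst_relabel.
have := admx; rewrite admissible_cons => /and3P[/allP ax ka kx].
have := admy; rewrite admissible_cons => /and3P[_ kc ky].
have eqac : a.2 = c.2 -> a = c.
  by move: a c ac {IH admx admy lac ax ka kc} => [? ?] [? ?]/= -> ->.
have [ag|ag] := eqVneq a.1 g.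
  have ux := tail_below_unlabelled admx ag.
  have uy := tail_below_unlabelled admy (etrans (esym ac) ag).
  rewrite (unlabelled_eq ux uy fxy).
  have [eq2|neq2] := eqVneq a.2 c.2; first by left; rewrite eqac.
  right; rewrite /= ag eqxx /=; congr (_ :: _).
  rewrite /flip_letter ag eqxx; move: neq2 ac ag.
  by case: (a) (c) => [? []] [? []]//= _ -> ->.
have eq2 : a.2 = c.2.
  move: lac ka kc; rewrite -ac k'_g k_g /slt (eq_sym g) ag andbT.
  by case: (le g a.1); case: (a.2); case: (c.2).
have ac' := eqac eq2.
have [a2|a2] := boolP a.2; last first.
  left; rewrite -ac'; congr (_ :: _).
  apply: unlabelled_eq (esym fxy).
    by apply: tail_unlabelled admy _; rewrite -eq2.
  exact: tail_unlabelled admx a2.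
have [->|->] := IH y kx ky rxy; first by left; rewrite ac'.
by right; rewrite /= ag a2 /flip_letter (negPf ag) ac'.
Qed.

End AdjacentPair.

Lemma relabel_unlabelled k a x : upward_closed k ->
  all (letter_order a) x -> ~~ (a.2 && k a.1) -> unlabelled (relabel k x).
Proof.
move=> up /allP ax na; rewrite /unlabelled /relabel all_map; apply/allP => c cx /=.
apply: contra na => /andP[c2 kc].
have /andP[ca /implyP/(_ c2) ->] := ax _ cx.
exact: up kc (slt_le ca).
Qed.

(** The letters keeping the label [true] form a prefix, as [k] is upward closed
    and labels [true] come first; this prefix determines the relabelled word. *)
Lemma relabel_eq_prefix k x y : upward_closed k ->
  forall kx ky, admissible kx x -> admissible ky y -> map fst x = map fst y ->
  (forall u v, x = u ++ v -> all (fun a => a.2 && k a.1) u ->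
     exists v', y = u ++ v') ->
  (forall u v, y = u ++ v -> all (fun a => a.2 && k a.1) u ->
     exists v', x = u ++ v') ->
  relabel k x = relabel k y.
Proof.
move=> up kx ky; elim: x y => [|a x IH] [|c y]//= admx admy [ac fxy] hx hy.
have := admx; rewrite admissible_cons => /and3P[ax _ adx].
have := admy; rewrite admissible_cons => /and3P[ay _ ady].
have [akeep|anot] := boolP (a.2 && k a.1).
  have [|v' [ca _]] := hx [:: a] x erefl; first by rewrite /= akeep.
  rewrite ca akeep; congr (_ :: _); apply: IH => // u v xuv ku.
  - have [||v1 [_ ->]] := hx (a :: u) v; rewrite ?xuv//= ?akeep//.
    by exists v1.
  - have [||v1 [->]] := hy (a :: u) v; rewrite ?xuv ?ca//= ?akeep//.
    by exists v1.
have cnot : ~~ (c.2 && k c.1).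
  apply: contra anot => ckeep.
  have [|v' [-> _]] := hy [:: c] y erefl; last by [].
  by rewrite /= ckeep.
rewrite (negPf cnot) ac; congr (_ :: _); apply: unlabelled_eq.
- exact: relabel_unlabelled up ax anot.
- exact: relabel_unlabelled up ay cnot.
- by rewrite !map_fst_relabel.
Qed.

End Words.

(** * The space of admissible words *)

Section PointDistance.
Context {R : realType} {W : eqType} (n : W -> nat).

Definition ruler_dist (i : bool) (x : seq (W * bool)) : R :=
  3 + i%:R + height n x.

(** The rulers [inl false] and [inl true] are joined to the root of the tree by
    paths of length [3] and [4].  Their mutual distance [2] exceeds that of any
    two words and is less than that of a ruler and a word. *)
Definition point_dist (p q : bool + seq (W * bool)) : R :=
  match p, q with
  | inl i, inl j => if i == j then 0 else 2
  | inl i, inr y => ruler_dist i y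
  | inr x, inl j => ruler_dist j x
  | inr x, inr y => word_dist n x y
  end.

Lemma ruler_dist_ge3 i x : 3 <= ruler_dist i x.
Proof. by rewrite /ruler_dist -addrA lerDl addr_ge0 ?height_ge0. Qed.

Lemma point_distxx p : point_dist p p = 0.
Proof. by case: p => [i|x] /=; rewrite ?eqxx ?word_distxx. Qed.

Lemma point_dist_sym p q : point_dist p q = point_dist q p.
Proof. by case: p q => [i|x] [j|y] //=; rewrite 1?eq_sym// word_dist_sym. Qed.

Lemma point_dist_eq0 p q : point_dist p q = 0 -> p = q.
Proof.
case: p q => [i|x] [j|y] /=.
- by case: eqP => [->//|_] h; exfalso; lra.
- by have := ruler_dist_ge3 i y => h1 h2; exfalso; lra.
- by have := ruler_dist_ge3 j x => h1 h2; exfalso; lra.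
- by move=> /word_dist_eq0 ->.
Qed.

Lemma point_dist_triangle q p r :
  point_dist p r <= point_dist p q + point_dist q r.
Proof.
have b01 (b : bool) : 0 <= b%:R :> R /\ b%:R <= 1 :> R.
  by case: b; split; rewrite ?lexx ?ler01.
case: p q r => [i|x] [j|y] [l|z] /=; rewrite /ruler_dist.
- by case: (i) (j) (l) => [] [] [] /=; lra.
- by have := height_ge0 (R := R) n z; case: (i) (j) => [] []/=; lra.
- have := height_ge0 (R := R) n y; have [] := b01 i; have [] := b01 l.
  by case: ifP => _; lra.
- by have := height_le (R := R) n z y; rewrite word_dist_sym; lra.
- have := height_ge0 (R := R) n x; have [] := b01 j; have [] := b01 l.
  by have := b01 j; case: (j) (l) => [] []/=; lra.
- have := word_dist_le (R := R) n x z; have [] := b01 j; lra.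
- have := height_le (R := R) n x y; lra.
- exact: word_dist_triangle.
Qed.

End PointDistance.

Definition admissible_point (W : eqType) (le : rel W) (k : pred W)
    (p : bool + seq (W * bool)) : bool :=
  if p is inr x then admissible le k x else true.

(** The parameters [R] and [n] only determine the distance put on the points. *)
Record space (R : realType) (W : eqType) (le : rel W) (n : W -> nat)
    (k : pred W) := Point {
  pt :> bool + seq (W * bool);
  ptP : admissible_point le k pt }.

HB.instance Definition _ (R : realType) (W : eqType) (le : rel W)
  (n : W -> nat) (k : pred W) := gen_eqMixin (space R le n k).
HB.instance Definition _ (R : realType) (W : eqType) (le : rel W)
  (n : W -> nat) (k : pred W) := gen_choiceMixin (space R le n k).

Section SpaceMetric.
Context {R : realType} {W : eqType} {le : rel W} {n : W -> nat} {k : pred W}.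
Implicit Types p q r : space R le n k.

Lemma point_inj p q : p = q :> (bool + seq (W * bool)) -> p = q.
Proof.
case: p q => [p hp] [q hq] /= pq; case: q / pq hq => hq.
by rewrite (bool_irrelevance hp hq).
Qed.

Definition space_dist p q : R := point_dist n p q.

Lemma space_distxx p : space_dist p p = 0.
Proof. exact: point_distxx. Qed.

Lemma space_dist_eq0 p q : space_dist p q = 0 -> p = q.
Proof. by move=> /point_dist_eq0/point_inj. Qed.

Lemma space_dist_sym p q : space_dist p q = space_dist q p.
Proof. exact: point_dist_sym. Qed.

Lemma space_dist_triangle q p r :
  space_dist p r <= space_dist p q + space_dist q r.
Proof. exact: point_dist_triangle. Qed.

HB.instance Definition _ := isMetric.Build R (space R le n k)
  space_distxx space_dist_eq0 space_dist_sym space_dist_triangle.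

Lemma mdistE p q : mdist p q = point_dist n p q.
Proof. by []. Qed.

End SpaceMetric.

Section Compactness.
Context {R : realType} {W : eqType} (le : rel W) (n : W -> nat) (k : pred W).
Hypotheses (le_wo : well_order le) (n_inj : injective n).

Definition cylinder (u : seq (W * bool)) : set (space R le n k) :=
  [set p | exists v, pt p = inr (u ++ v)].

Lemma cylinder_admissible u : cylinder u !=set0 -> admissible le k u.
Proof.
by move=> [[p hp] [v /= pv]]; move: hp; rewrite pv /= => /admissible_catl.
Qed.

(** An ultrafilter on a branch whose children are all negligible converges to
    the root of the branch, since the children shrink to it. *)
Lemma cylinder_ultra (F : set_system (space R le n k)) u : UltraFilter F ->
  F (cylinder u) ->
  (exists a, F (cylinder (rcons u a))) \/ exists p : space R le n k, F --> p.
Proof.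
move=> UF Fu; have [|none] := pselect (exists a, F (cylinder (rcons u a))).
  by left.
have Fnot a : F (~` cylinder (rcons u a)).
  have [h|//] := in_ultra_setVsetC (cylinder (rcons u a)) UF.
  by exfalso; apply: none; exists a.
right; have adu : admissible le k u by apply: cylinder_admissible (filter_ex Fu).
pose p := Point R n (adu : admissible_point le k (inr u)).
(* As [n] is injective, only finitely many letters are excluded. *)
have Fmany N : F [set q | forall a, (n a.1 < N)%N -> ~ cylinder (rcons u a) q].
  elim: N => [|N IH]; first exact: filterS filterT.
  have [[b bN]|nob] := pselect (exists b, n b = N); last first.
    apply: filterS IH => q h a; rewrite ltnS leq_eqVlt => /orP[/eqP aN|/h//].
    by exfalso; apply: nob; exists a.1.
  apply: filterS (filterI IH (filterI (Fnot (b, true)) (Fnot (b, false)))).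
  move=> q [h [ht hf]] [d l]; rewrite ltnS leq_eqVlt => /orP[/eqP aN|/h//].
  have -> : d = b by apply: n_inj; rewrite bN -aN.
  by case: l {aN}.
exists p; apply/metricType_numDomainType.fcvgrPdist_lt => e e0.
have [N Ne] : exists N, (2^-1 : R) ^+ N < e.
  have [N] := filter_ex (near_infty_natSinv_expn_lt (PosNum e0)).
  by rewrite /= mul1r -exprVn => h; exists N.
apply: filterS (filterI Fu (Fmany N)) => q [[v qv] qN].
rewrite mdistE qv /= -[X in word_dist _ X]cats0 word_dist_cat word_dist0l.
case: v qv => [|a v] qv; first by rewrite mulr0.
have aN : (N <= n a.1)%N.
  rewrite leqNgt; apply/negP => /qN; apply.
  by exists v; rewrite qv cat_rcons.
apply: (@le_lt_trans _ _ (height n (a :: v))).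
  by rewrite ler_piMl ?height_ge0 ?scale_le1.
apply: (lt_trans (height_cons_lt n a v)); apply: le_lt_trans Ne.
by rewrite ler_wiXn2l ?invr_ge0// invf_le1 ?ler1n.
Qed.

Lemma space_compact : compact [set: space R le n k].
Proof.
rewrite compact_ultra => F UF _.
suff [p Fp] : exists p : space R le n k, F --> p by exists p.
have cyl u : F (cylinder u) -> exists p : space R le n k, F --> p.
  (* An induction on the last letter [b] of the branch. *)
  suff main b : forall v l, F (cylinder (rcons v (b, l))) ->
      exists p : space R le n k, F --> p.
    move=> Fu; have [[[b l]]|//] := cylinder_ultra UF Fu; exact: main.
  elim/(well_founded_ind (wo_wf le_wo)): b => b IH v l Fv.
  have [[[d m] Fd]|//] := cylinder_ultra UF Fv; apply: IH (Fd).
  have : admissible le k (rcons (rcons v (b, l)) (d, m)).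
    exact: cylinder_admissible (filter_ex Fd).
  rewrite -!cats1 -catA => /andP[]; rewrite pairwise_cat => /and3P[_ _ /=].
  by rewrite andbT => /andP[/andP[]].
have Fpt i : F [set p | pt p = inl i] -> exists p : space R le n k, F --> p.
  move=> Fi; exists (Point R n (isT : admissible_point le k (inl i))).
  apply/metricType_numDomainType.fcvgrPdist_lt => e e0; apply: filterS Fi => q /= qi.
  by rewrite mdistE qi point_distxx.
have [/Fpt//|Fn0] := in_ultra_setVsetC [set p | pt p = inl true] UF.
have [/Fpt//|Fn1] := in_ultra_setVsetC [set p | pt p = inl false] UF.
apply: (cyl [::]); apply: filterS (filterI Fn0 Fn1) => -[[[]|x] hx] [] //= _ _.
by exists x.
Qed.

End Compactness.

(** * Isometries of the space of admissible words *)

Section MetricGeneralities.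
Context {R : realType}.

Lemma isometry_inj (X Y : metricType R) (f : X -> Y) :
  is_isometry f -> injective f.
Proof.
by move=> fi x y fxy; apply: mdist_positivity; rewrite -fi fxy mdistxx.
Qed.

Lemma iso_equiv_refl (X : metricType R) (x : X) : iso_equiv x x.
Proof. by exists id; split=> // z; exists z. Qed.

Lemma iso_equiv_sym (X : metricType R) (x y : X) :
  iso_equiv x y -> iso_equiv y x.
Proof.
move=> [f [fi fs fxy]]; have [h fh] := choice fs.
exists h; split=> [u v|z|]; first by rewrite -fi !fh.
  by exists (f z); apply: (isometry_inj fi); rewrite fh.
by apply: (isometry_inj fi); rewrite fh fxy.
Qed.

End MetricGeneralities.

Section Isometries.
Context {R : realType} {W : eqType} (le : rel W) (n : W -> nat) (k : pred W).
Hypothesis n_inj : injective n.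

Local Notation S := (space R le n k).

Definition ruler i : S := Point R n (isT : admissible_point le k (inl i)).

Definition empty_word : S := Point R n (isT : admissible_point le k (inr [::])).

Lemma point_dist_eq2 (p q : bool + seq (W * bool)) :
  point_dist (R := R) n p q = 2 ->
  exists i, p = inl i /\ q = inl (~~ i).
Proof.
case: p q => [i|x] [j|y] /=.
- case: eqVneq => [_ h|ij _]; first by exfalso; lra.
  by exists i; split=> //; case: i j ij => [] [].
- by have := ruler_dist_ge3 (R := R) n i y => h1 h2; exfalso; lra.
- by have := ruler_dist_ge3 (R := R) n j x => h1 h2; exfalso; lra.
- by have := word_dist_lt2 (R := R) n x y => h1 h2; exfalso; lra.
Qed.

Section FixedIsometry.
Variable phi : S -> S.
Hypothesis phi_iso : is_isometry phi.

(** The two rulers form the only pair of points at distance [2], and the empty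
    word, at distance [3] from one and [4] from the other, keeps them apart. *)
Lemma ruler_fixed i : phi (ruler i) = ruler i.
Proof.
have tf : point_dist (R := R) n (phi (ruler true)) (phi (ruler false)) = 2.
  by rewrite -mdistE phi_iso.
have [[] [pt pf]] := point_dist_eq2 tf.
  by apply: point_inj; case: i.
have := phi_iso (ruler false) empty_word; rewrite !mdistE pf /=.
rewrite /ruler_dist /= !addr0; case: (phi empty_word) => [[[]|y] hy] /=.
- by move=> h; exfalso; lra.
- by move=> h; exfalso; lra.
- by rewrite /ruler_dist; have := height_ge0 (R := R) n y => h1 h2; exfalso; lra.
Qed.

(** The distance to a fixed ruler is, up to a constant, the height. *)
Lemma isometry_word p x : pt p = inr x ->
  exists2 y, pt (phi p) = inr y & map fst y = map fst x.
Proof.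
move=> px; case phip : (pt (phi p)) => [i|y].
  have pi : p = ruler i.
    by apply: (isometry_inj phi_iso); rewrite ruler_fixed; apply: point_inj.
  by move: px; rewrite pi.
exists y => //; have := phi_iso (ruler true) p.
rewrite ruler_fixed !mdistE px phip /= => /addrI.
exact: height_inj.
Qed.

(** Appending the letter [g] with either label to the prefix [u] gives two words
    whose distance determines how far their images agree.  As both labels of
    [g] occur in these images, and nothing can be labelled [true] after
    [false], the common beginning of the images has all its labels [true],
    hence is [u]; and the image of [p] stays on this branch. *)
Lemma isometry_prefix g p q u v y : k g -> upward_closed le k ->
  phi p = q -> pt p = inr (u ++ v) -> pt q = inr y ->
  all (fun a => a.2 && slt le g a.1) u -> exists v', y = u ++ v'.
Proof.
move=> kg up pq pu qy /allP gu.
have adm_u : admissible le k u.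
  by move: (ptP p); rewrite pu => /admissible_catl.
have adm l : admissible_point le k (inr (rcons u (g, l))).
  move: adm_u => /andP[pw ku] /=; rewrite /admissible -cats1 pairwise_cat pw.
  rewrite all_cat ku /= kg implybT !andbT; apply/allrelP => a c au.
  rewrite inE => /eqP ->; have /andP[a2 ga] := gu _ au.
  by rewrite /letter_order a2 implybT ga.
pose t l := Point R n (adm l).
have image l : exists u' m, pt (phi (t l)) = inr (rcons u' (g, m)) /\
    map fst u' = map fst u.
  have [z phiz] := isometry_word (erefl : pt (t l) = inr (rcons u (g, l))).
  case/lastP: z phiz => [|u' [h m]] phiz; rewrite !map_rcons.
    by move=> /(congr1 size); rewrite size_rcons.
  by move=> /rcons_inj[fu] /= hg; exists u', m; rewrite phiz hg.
have [u1 [m1 [im1 f1]]] := image true; have [u2 [m2 [im2 f2]]] := image false.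
have height1 c : height (R := R) n [:: c] = weight n c by rewrite /= addr0 mulr1.
have weight_fst c d : weight (R := R) n (g, c) = weight n (g, d) by [].
have u12 : u1 = u2.
  apply: (@word_dist_prefix_eq R _ n _ _ [:: (g, m1)] [:: (g, m2)]).
    by rewrite f1 f2.
  have := phi_iso (t true) (t false); rewrite !mdistE im1 im2 /=.
  rewrite -!cats1 word_dist_cat word_dist_neq ?xpair_eqE ?andbF// => ->.
  by rewrite (scale_map_fst (R := R) n f1) !height1 !addr0 !mulr1 lexx.
(* The images are distinct, so one of them ends with [g] labelled [true]. *)
have m12 : m1 != m2.
  apply/eqP => m12; have : t true = t false.
    by apply: (isometry_inj phi_iso); apply: point_inj; rewrite im1 im2 u12 m12.
  move=> /(congr1 (@pt _ _ _ _ _)) [] /(congr1 (last (g, true))).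
  by rewrite !last_rcons.
have true_u1 : all (fun a => a.2) u1.
  have true_image l u' : pt (phi (t l)) = inr (rcons u' (g, true)) ->
      all (fun a => a.2) u'.
    move=> im; have := ptP (phi (t l)); rewrite im /= => /andP[+ _].
    rewrite -cats1 pairwise_cat => /andP[/allrelP ord _].
    apply/allP => a au; have := ord a (g, true) au.
    by rewrite inE eqxx => /(_ isT)/andP[].
  case: m1 m2 m12 im1 im2 => [] [] // _ im1 im2; first exact: true_image im1.
  by rewrite u12; exact: true_image im2.
have u1u : u1 = u.
  elim: (u1) (u) f1 true_u1 gu => [|[b l] s IH] [|[c m] s']//= [-> fs].
  move=> /andP[/= -> ts] hs; have /andP[/= -> _] := hs (c, m) (mem_head _ _).
  by congr (_ :: _); apply: IH => // a as'; apply: hs; rewrite inE as' orbT.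
(* Now that [u] is the beginning of the image of [t true], compare [p] with
   [t true]: both run through [u], hence so do their images. *)
have [y' + fy] := isometry_word pu; rewrite pq qy => -[yy']; rewrite -{}yy' in fy.
pose w := take (size u) y; pose v' := drop (size u) y.
have yw : y = w ++ v' by rewrite cat_take_drop.
have fw : map fst w = map fst u.
  by rewrite /w map_take fy map_cat take_size_cat// size_map.
have fv : map fst v' = map fst v.
  by rewrite /v' map_drop fy map_cat drop_size_cat// size_map.
suff <- : w = u by exists v'.
apply: (@word_dist_prefix_eq R _ n _ _ v' [:: (g, m1)]) => //.
have := phi_iso p (t true); rewrite pq !mdistE qy yw im1 u1u pu /=.
rewrite -!cats1 word_dist_cat => ->.
rewrite (scale_map_fst n fw) ler_pM2l ?scale_gt0// addr0 mulr1.
by rewrite (height_map_fst n fv) (weight_fst m1 true) -height1 word_dist_le.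
Qed.

End FixedIsometry.

End Isometries.

(** * The sequence of iso-derivatives *)

Lemma well_order_succ (W : eqType) (le : rel W) :
  well_order le -> well_order (succ_le le).
Proof.
move=> le_wo; apply: antisymmetric_well_order => [[b|] [d|]//|A [b0 Ab0]].
  by move=> /(wo_antisym le_wo) ->.
have [[b Ab]|none] := pselect (exists b, Some b \in A); last first.
  have noA b : Some b \in A -> False by move=> Ab; apply: none; exists b.
  exists None; split=> [|[b|]//]; last by move=> /noA.
  by case: b0 Ab0 => // b /noA.
have [|z [[Az zl] _]] := le_wo [pred b | Some b \in A]; first by exists b.
exists (Some z); split; first exact: Az.
by move=> [d|] //= Ad; apply: zl.
Qed.

Section Stages.
Context {R : realType} {W : eqType} (le : rel W) (n : W -> nat).
Hypotheses (le_wo : well_order le) (n_inj : injective n).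

Local Notation ord := (succ_le (succ_le le)).
Implicit Types (c d : option (option W)).

Let ord_wo : well_order ord := well_order_succ (well_order_succ le_wo).

(** [Some (Some b)] stands for the ordinal [b] of [W]; at stage [c], the letters
    that can still be labelled [true] are those [>= c]. *)
Definition keep c : pred W := fun b => ord c (Some (Some b)).

Definition stage c : metricType R := space R le n (keep c).

Lemma keep_up c : upward_closed le (keep c).
Proof. by move=> b d cb bd; apply: (wo_trans ord_wo) cb _. Qed.

Lemma keep_anti c d b : ord c d -> keep d b -> keep c b.
Proof. exact: (wo_trans ord_wo). Qed.

Definition relabel_point (k : pred W) (p : bool + seq (W * bool)) :=
  match p with inl i => inl i | inr x => inr (relabel k x) end.

Lemma relabel_pointP k c p : admissible_point le k p ->
  admissible_point le (keep c) (relabel_point (keep c) p).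
Proof. by case: p => //= x; apply: relabel_admissible; exact: keep_up. Qed.

Lemma relabel_point_id k p : admissible_point le k p -> relabel_point k p = p.
Proof. by case: p => //= x /andP[_ kx]; rewrite relabel_id. Qed.

Lemma relabel_point_comp c d p : ord c d ->
  relabel_point (keep d) (relabel_point (keep c) p) = relabel_point (keep d) p.
Proof.
by move=> cd; case: p => //= x; rewrite relabel_relabel// => b; exact: keep_anti.
Qed.

Definition proj k c (p : space R le n k) : stage c :=
  Point R n (relabel_pointP c (ptP p)).

Lemma proj_nonexpansive k c : nonexpansive (@proj k c).
Proof.
move=> p q; rewrite !mdistE /=; case: (pt p) (pt q) => [i|x] [j|y]//=.
- by rewrite /ruler_dist (height_map_fst n (map_fst_relabel _ _)).
- by rewrite /ruler_dist (height_map_fst n (map_fst_relabel _ _)).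
- exact: relabel_nonexpansive.
Qed.

Definition incl c d (cd : ord c d) (p : stage d) : stage c.
Proof.
exists (pt p); abstract (case: p => -[i//|x] /=; apply: admissible_weaken => b;
  exact: keep_anti cd).
Defined.

Lemma proj_incl c d (cd : ord c d) (p : stage d) : proj d (incl cd p) = p.
Proof. by apply: point_inj; rewrite /= relabel_point_id ?ptP. Qed.


(** ** Successor stages *)

Definition flip_point g (p : bool + seq (W * bool)) :=
  match p with inl i => inl i | inr x => inr (flip g x) end.

Lemma iso_equiv_flip g (p q : stage (Some (Some g))) :
  pt q = flip_point g (pt p) -> iso_equiv p q.
Proof.
have flipP (r : stage (Some (Some g))) :
    admissible_point le (keep (Some (Some g))) (flip_point g (pt r)).
  case: r => -[i//|x] /= adx.
  exact: (flip_admissible le_wo (fun=> erefl)).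
pose f r : stage (Some (Some g)) := Point R n (flipP r).
have fK : involutive f.
  move=> r; apply: point_inj => /=.
  by case: (pt r) => //= x; rewrite flipK.
move=> qp; exists f; split; [|by move=> z; exists (f z)|by apply: point_inj].
move=> r s; rewrite !mdistE /=; case: (pt r) (pt s) => [i|x] [j|y] //=.
- by rewrite /ruler_dist (height_map_fst n (map_fst_flip _ _)).
- by rewrite /ruler_dist (height_map_fst n (map_fst_flip _ _)).
- exact: flip_isometry.
Qed.

Lemma keep_succ g c : is_succ ord (Some (Some g)) c ->
  forall b, keep c b = slt le g b.
Proof.
move=> [/andP[gc ngc] cmin] b; apply/idP/idP => [cb|gb]; last first.
  apply: cmin; move: gb; rewrite /slt /= => /andP[-> /=].
  by apply: contra => /eqP[->].
rewrite sltNle//; apply/negP => bg; move/negP: ngc; apply; apply/eqP.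
by apply: (wo_antisym ord_wo); rewrite gc /= (wo_trans ord_wo cb).
Qed.

Lemma keep_succ_top c d : is_succ ord c d -> (forall g, c <> Some (Some g)) ->
  forall b, keep d b = false.
Proof.
move=> [/andP[cd _] _] cg b; apply/negP => db.
have := wo_trans ord_wo cd db.
by case: c cg {cd} => [[g|]|] // /(_ g).
Qed.

Lemma isometry_fixes_prefix c d (p q : stage c) x y u v : is_succ ord c d ->
  iso_equiv p q -> pt p = inr x -> pt q = inr y -> x = u ++ v ->
  all (fun a => a.2 && keep d a.1) u -> exists v', y = u ++ v'.
Proof.
move=> cd [phi [phi_iso _ phi_pq]] px qy xuv ku.
have [[g cg]|ng] := pselect (exists g, c = Some (Some g)); last first.
  have noc g : c <> Some (Some g) by move=> cg; apply: ng; exists g.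
  exists y; case: u ku {xuv} => //= a u.
  by rewrite (keep_succ_top cd noc) andbF.
rewrite cg in p q cd phi phi_iso phi_pq px qy *.
rewrite xuv in px.
apply: (isometry_prefix n_inj phi_iso _ (@keep_up _) phi_pq px qy).
  exact: (wo_refl ord_wo).
by apply: sub_all ku => a; rewrite (keep_succ cd).
Qed.

Lemma proj_fiber c d (p q : stage c) : is_succ ord c d ->
  proj d p = proj d q <-> iso_equiv p q.
Proof.
move=> cd; split=> [/(congr1 (@pt _ _ _ _ _)) /= pq|pq]; last first.
  apply: point_inj => /=; have := pq => -[phi [phi_iso _ phi_pq]].
  case px : (pt p) => [i|x].
    have -> : q = p; last by rewrite px.
    rewrite -phi_pq; have -> : p = ruler le n (keep c) i by apply: point_inj.
    exact: ruler_fixed.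
  have [y] := isometry_word n_inj phi_iso px.
  rewrite phi_pq => qy fxy; rewrite qy /=; congr inr.
  have := ptP p; have := ptP q; rewrite px qy /= => ady adx.
  apply: (relabel_eq_prefix (@keep_up d) adx ady (esym fxy)) => u v.
    exact: isometry_fixes_prefix cd pq px qy.
  exact: isometry_fixes_prefix cd (iso_equiv_sym pq) qy px.
have [[g cg]|ng] := pselect (exists g, c = Some (Some g)); last first.
  have noc g : c <> Some (Some g) by move=> cg; apply: ng; exists g.
  suff -> : p = q by exact: iso_equiv_refl.
  apply: point_inj; move: pq.
  have kcd : keep d = keep c.
    apply/funext => b; rewrite (keep_succ_top cd noc).
    by case: c noc {p q cd ng} => [[g|]|] // /(_ g).
  by rewrite kcd !relabel_point_id ?ptP.
rewrite cg in p q cd pq *.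
case px : (pt p) pq => [i|x]; case qy : (pt q) => [j|y] //= [pq].
  suff -> : p = q by exact: iso_equiv_refl.
  by apply: point_inj; rewrite px qy pq.
have := ptP p; have := ptP q; rewrite px qy /= => ady adx.
have [yx|yx] := eq_relabel_flip le_wo (fun=> erefl) (keep_succ cd) adx ady pq.
  suff -> : p = q by exact: iso_equiv_refl.
  by apply: point_inj; rewrite px qy yx.
by apply: iso_equiv_flip; rewrite px qy yx.
Qed.

(** The quotient carries the distance induced from [stage d] itself, since the
    projection is a retraction onto it. *)
Lemma proj_iso_derivative c d : is_succ ord c d ->
  is_iso_derivative (@proj (keep c) d).
Proof.
move=> cd; have ocd : ord c d by case: cd => /andP[].
split.
- by move=> q; exists (incl ocd q); rewrite proj_incl.
- by move=> p q; exact: proj_fiber.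
- exact: proj_nonexpansive.
- move=> rho _ hrho p q.
  by have := hrho (incl ocd p) (incl ocd q); rewrite !proj_incl.
Qed.

(** ** Limit stages *)

Lemma limit_above a c d : slt ord c a -> slt ord d a ->
  exists e, [/\ ord c e, ord d e & slt ord e a].
Proof.
move=> ca da; have /orP[cd|dc] := wo_total ord_wo c d.
  by exists d; split=> //; exact: (wo_refl ord_wo).
by exists c; split=> //; exact: (wo_refl ord_wo).
Qed.

(** A word has finitely many letters, so the relabelling performed at a limit
    stage is already complete at some earlier stage. *)
Lemma keep_limit a c (x : seq (W * bool)) : is_limit ord a -> slt ord c a ->
  exists d, [/\ ord c d, slt ord d a & {in x, forall e, keep d e.1 = keep a e.1}].
Proof.
move=> [_ lim] ca; elim: x => [|[b l] x [d [cd da IH]]].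
  by exists c; split=> //; exact: (wo_refl ord_wo).
have [ab|nab] := boolP (keep a b).
  exists d; split=> // e; rewrite inE => /orP[/eqP -> /=|]; last exact: IH.
  by rewrite ab (keep_anti (slt_le da) ab).
have [|e be ea] := lim (Some (Some b)); first by rewrite sltNle.
have [f [df ef fa]] := limit_above da ea.
exists f; split=> // [|t]; first exact: (wo_trans ord_wo) cd df.
rewrite inE => /orP[/eqP -> /=|tx].
  rewrite (negPf nab); apply/negbTE/negP => fb.
  move: be; rewrite sltNle// => /negP; apply.
  exact: (wo_trans ord_wo) ef fb.
apply/idP/idP => [/(keep_anti df)|/(keep_anti (slt_le fa))//].
by rewrite IH.
Qed.

Lemma relabel_limit a c p : is_limit ord a -> slt ord c a -> exists d,
  [/\ ord c d, slt ord d a & relabel_point (keep d) p = relabel_point (keep a) p].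
Proof.
move=> lim ca; case: p => [i|x].
  by exists c; split=> //; exact: (wo_refl ord_wo).
have [d [cd da dx]] := keep_limit x lim ca.
exists d; split=> //=; congr inr; apply/eq_in_map => e ex.
by rewrite dx.
Qed.

(** Viewing [stage a] inside an earlier stage turns any cocone into a map on
    [stage a]; a cocone identifies each point with its relabelling. *)
Lemma stage_inductive_limit a : is_limit ord a ->
  is_inductive_limit (X := stage) (fun c d (_ : ord c d) => @proj (keep c) d)
    (fun c (_ : slt ord c a) => @proj (keep c) a).
Proof.
move=> lim; split.
- exact: space_compact.
- split=> [c _|c d ca da cd p]; first exact: proj_nonexpansive.
  by apply: point_inj; exact: relabel_point_comp (slt_le da).
move=> Z _ f [f_ne f_co]; have [[c0 c0a] _] := lim.
pose u (p : stage a) : Z := f c0 c0a (incl (slt_le c0a) p).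
have uE c (ca : slt ord c a) (p : stage c) : u (proj a p) = f c ca p.
  have [e [ce c0e ea]] := limit_above ca c0a.
  have [d [ed da dp]] := relabel_limit (pt p) lim ea.
  have cd := wo_trans ord_wo ce ed; have c0d := wo_trans ord_wo c0e ed.
  rewrite /u -(f_co _ _ c0a da c0d) -(f_co _ _ ca da cd); congr (f d da _).
  apply: point_inj => /=; rewrite dp.
  by rewrite relabel_point_id// (ptP (incl (slt_le da) (proj a p))).
exists u; split.
  split=> [p q|c ca p]; last exact: uE.
  by have := f_ne c0 c0a (incl (slt_le c0a) p) (incl (slt_le c0a) q).
move=> w [_ wE]; apply/funext => p.
by rewrite /u -(wE c0 c0a) proj_incl.
Qed.

(** ** The iso-height *)

Definition full_space : metricType R := space R le n predT.

Lemma stage_zero c : is_zero ord c -> stage c = full_space.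
Proof.
move=> c0; rewrite /stage /full_space.
by have -> : keep c = predT by apply/funext => b; exact: c0.
Qed.

Lemma proj_id c (p : stage c) : proj c p = p.
Proof. by apply: point_inj; rewrite /= relabel_point_id ?ptP. Qed.

Lemma proj_comp c d e (p : stage c) : ord d e -> proj e p = proj e (proj d p).
Proof. by move=> de; apply: point_inj; rewrite /= relabel_point_comp. Qed.

Definition stages : iso_derivatives ord full_space :=
  @IsoDerivatives R (option (option W)) ord full_space stage
    (fun c => space_compact le_wo n_inj)
    (fun c d _ => @proj (keep c) d)
    (fun c _ => @proj_id c)
    stage_zero
    (fun c d _ => @proj_iso_derivative c d)
    (fun c d e _ de _ _ p => proj_comp p de)
    stage_inductive_limit.

Lemma stages_stable_top : stable_at stages (Some None).
Proof.
exists None, isT; split; first by split=> // -[[c|]|].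
move=> p q /=; rewrite !mdistE /=.
have relab (r : stage (Some None)) : relabel_point (keep None) r = r.
  by rewrite relabel_point_id// ptP.
by rewrite !relab.
Qed.

(** The two letters [g] are still distinct at stage [g], and identified at the
    next one. *)
Lemma stages_unstable g : ~ stable_at stages (Some (Some g)).
Proof.
move=> [c [gc [succ_c iso]]].
have adm l : admissible_point le (keep (Some (Some g))) (inr [:: (g, l)]).
  by rewrite /= /admissible /= andbT /keep /= (wo_refl le_wo) implybT.
pose t l : stage (Some (Some g)) := Point R n (adm l).
have : t true = t false.
  apply: (isometry_inj iso); apply: point_inj; rewrite /= (keep_succ succ_c).
  by rewrite /slt eqxx andbF.
by move=> /(congr1 (@pt _ _ _ _ _)).
Qed.

End Stages.

Theorem theorem5p8 (R : realType) (W : eqType) (le : rel W)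
  (le_wo : well_order le) (W_countable : countable [set: W]%classic) :
  exists X : metricType R, compact [set: X]%classic /\ iht_eq X le.
Proof.
have [n n_inj'] := countable_injP _ W_countable.
have n_inj : injective n by move=> b d; apply: n_inj'; exact: in_setT.
exists (full_space le n); split; first exact: space_compact.
exists (stages le_wo n_inj); split; first exact: stages_stable_top.
by move=> [[g|]|] // /stages_unstable.
Qed.
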